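(* For every $1\le q<\infty$, $$\mathcal C_q(\mathfrak O)=(2+4^q)^{1/q},$$ and $$\mathcal C_\infty(\mathfrak O)=4.$$ Every one of these constants is attained by $P_*(x,y)=-x^2+4xy-y^2$ and by its negative; that is, $|P|_q=\mathcal C_q(\mathfrak O)\,\|P\|_{\mathfrak O}$ for $P=\pm P_*$ and every $1\le q\le\infty$.
   Context: $\mathfrak O:=\{(x,y)\in[0,1]^2: x+y\le\sqrt2\}$. For a real quadratic form $P(x,y)=ax^2+bxy+cy^2$ put $\|P\|_{\mathfrak O}:=\sup_{(x,y)\in\mathfrak O}|P(x,y)|$, $|P|_q:=(|a|^q+|b|^q+|c|^q)^{1/q}$ for $1\le q<\infty$, and $|P|_\infty:=\max\{|a|,|b|,|c|\}$. For $1\le q\le\infty$, the coefficient constant is $$\mathcal C_q(\mathfrak O):=\sup_{P\ne0}\frac{|P|_q}{\|P\|_{\mathfrak O}},$$ the supremum being over nonzero real quadratic forms in two variables. *)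

(* Defs.v *)
From mathcomp Require Import all_boot all_order all_algebra.
From mathcomp Require Import all_classical all_reals all_analysis.
From mathcomp Require Import ring lra.

Set Implicit Arguments.
Unset Strict Implicit.
Unset Printing Implicit Defensive.

Import Order.TTheory GRing.Theory Num.Theory.

Local Open Scope classical_set_scope.
Local Open Scope ring_scope.

Definition quarter_octagon (R : realType) : set (R * R) :=
  [set z | [/\ 0 <= z.1 <= 1, 0 <= z.2 <= 1 & z.1 + z.2 <= Num.sqrt 2]].

(* The triple (a, b, c) stands for the form a x^2 + b x y + c y^2; zero and
   opposite are those of the product group. *)
Notation quadform R := (R * R * R)%type.

Definition qf_eval (R : realType) (P : quadform R) (z : R * R) : R :=
  let: (a, b, c) := P in a * z.1 ^+ 2 + b * (z.1 * z.2) + c * z.2 ^+ 2.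

(* The real-valued [sup] is the true supremum here: see [qf_supnorm_has_sup]. *)
Definition qf_supnorm (R : realType) (P : quadform R) : R :=
  sup [set `|qf_eval P z| | z in @quarter_octagon R].

(* The value at -oo is irrelevant: the exponents of interest satisfy 1 <= q. *)
Definition qf_coefnorm (R : realType) (q : \bar R) (P : quadform R) : R :=
  let: (a, b, c) := P in
  match q with
  | r%:E => (`|a| `^ r + `|b| `^ r + `|c| `^ r) `^ r^-1
  | +oo%E => Num.max `|a| (Num.max `|b| `|c|)
  | -oo%E => 0
  end.

(* Extended-real supremum, so that finiteness is not presupposed.  The
   denominators are nonzero by [qf_supnorm_gt0]. *)
Definition coef_const (R : realType) (q : \bar R) : \bar R :=
  ereal_sup [set (qf_coefnorm q P / qf_supnorm P)%:E
            | P in [set P : quadform R | P != 0]].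

Definition Pstar (R : realType) : quadform R := (-1, 4, -1).

Lemma sqrt2_ge1 (R : realType) : 1 <= Num.sqrt (2 : R).
Proof. by rewrite -[leLHS]sqrtr1 ler_wsqrtr// ler1n. Qed.

Lemma qf_supnorm_has_sup (R : realType) (P : quadform R) :
  has_sup [set `|qf_eval P z| | z in @quarter_octagon R].
Proof.
split.
  exists `|qf_eval P (0, 0)|, (0, 0) => //; split => //=; rewrite ?lexx ?ler01//.
  by rewrite addr0 sqrtr_ge0.
move: P => [[a b] c]; exists (`|a| + `|b| + `|c|) => _ [[x y] [/= hx hy _] <-] /=.
case/andP: hx => x0 x1; case/andP: hy => y0 y1.
have H (u v : R) : 0 <= v <= 1 -> `|u * v| <= `|u|.
  by case/andP=> v0 v1; rewrite normrM (ger0_norm v0) ler_piMr.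
apply: (le_trans (ler_normD _ _)); apply: lerD.
  apply: (le_trans (ler_normD _ _)); apply: lerD; apply: H.
    by rewrite exprn_ge0//= exprn_ile1.
  by rewrite mulr_ge0//= mulr_ile1.
by apply: H; rewrite exprn_ge0//= exprn_ile1.
Qed.

Lemma le_qf_supnorm (R : realType) (P : quadform R) (z : R * R) :
  quarter_octagon z -> `|qf_eval P z| <= qf_supnorm P.
Proof.
by move=> Oz; apply: (sup_upper_bound (qf_supnorm_has_sup P)); exists z.
Qed.

Lemma qf_supnorm_gt0 (R : realType) (P : quadform R) :
  P != 0 -> 0 < qf_supnorm P.
Proof.
have s1 := sqrt2_ge1 R.
have O (x y : R) : 0 <= x <= 1 -> 0 <= y <= 1 -> x + y <= 1 -> quarter_octagon (x, y).
  by move=> ? ? xy; split => //=; exact: le_trans xy s1.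
have O1 : quarter_octagon (1, 0 : R) by apply: O; lra.
have O2 : quarter_octagon (0, 1 : R) by apply: O; lra.
have O3 : quarter_octagon (2^-1, 2^-1 : R) by apply: O; lra.
apply: contra_neqT; rewrite -leNgt => P0.
have Z z : quarter_octagon z -> qf_eval P z = 0.
  move=> Oz; apply/eqP; rewrite -normr_le0.
  exact: le_trans (le_qf_supnorm P Oz) P0.
move: P Z {P0} => [[a b] c] Z.
have := Z _ O1; have := Z _ O2; have := Z _ O3; rewrite /= => h3 h2 h1.
have a0 : a = 0 by lra.
have c0 : c = 0 by lra.
have b0 : b = 0 by move: h3; rewrite a0 c0; lra.
by rewrite a0 b0 c0.
Qed.

(* Main.v *)
(** The point (1/sqrt 2, 1/sqrt 2) lies on the edge x + y = sqrt 2 of the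
    quarter octagon, so evaluating at (1, 0), (0, 1) and at this point gives
    |a| <= N, |c| <= N and |a + b + c| <= 2 N for N the sup norm of
    P = a x^2 + b x y + c y^2, whence |b| <= 4 N.  Every coefficient norm is
    monotone in |a|, |b|, |c|, so it is at most N times its value at
    P_* = - x^2 + 4 x y - y^2; and P_* itself has sup norm 1. *)
Require Import Defs.
From mathcomp Require Import all_boot all_order all_algebra.
From mathcomp Require Import all_classical all_reals all_analysis.
From mathcomp Require Import lra.

Import Order.TTheory GRing.Theory Num.Theory.

Local Open Scope classical_set_scope.
Local Open Scope ring_scope.

Lemma qf_coef_bounds (R : realType) (a b c : R) (N := qf_supnorm (a, b, c)) :
  [/\ `|a| <= N, `|b| <= 4 * N & `|c| <= N].
Proof.
set s : R := Num.sqrt 2.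
have s1 : 1 <= s := sqrt2_ge1 R.
have s2 : s ^+ 2 = 2 by rewrite sqr_sqrtr.
have s_le2 : s <= 2 by nra.
have bound x y : 0 <= x <= 1 -> 0 <= y <= 1 -> x + y <= s ->
    `|a * x ^+ 2 + b * (x * y) + c * y ^+ 2| <= N.
  by move=> x01 y01 xy; apply: (@le_qf_supnorm R (a, b, c) (x, y)); split.
have ha : `|a| <= N.
  have := @bound 1 0; rewrite expr1n expr0n /= !mulr0 mulr1 !addr0.
  by apply; lra.
have hc : `|c| <= N.
  have := @bound 0 1; rewrite expr1n expr0n /= mul0r !mulr0 mulr1 !add0r.
  by apply; lra.
have hm : `|a + b + c| <= 2 * N.
  (* Here [s / 2] is 1/sqrt 2; it lies in the unit interval because [s <= 2]. *)
  have /bound : 0 <= s / 2 <= 1 by lra.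
  move=> /(_ (s / 2)) hs.
  have {hs} : `|a * (s / 2) ^+ 2 + b * (s / 2 * (s / 2)) + c * (s / 2) ^+ 2| <= N.
    by apply: hs; lra.
  have -> : a * (s / 2) ^+ 2 + b * (s / 2 * (s / 2)) + c * (s / 2) ^+ 2
          = (a + b + c) / 2.
    by rewrite -expr2 exprMn s2 exprVn; lra.
  by rewrite !ler_norml; lra.
(* |b| <= |a + b + c| + |a| + |c| <= 2N + N + N. *)
by split=> //; move: ha hc hm; rewrite !ler_norml; lra.
Qed.

Lemma qf_coefnorm_le (R : realType) (q : \bar R) (a b c a' b' c' : R) :
  (1 <= q)%E -> `|a| <= `|a'| -> `|b| <= `|b'| -> `|c| <= `|c'| ->
  qf_coefnorm q (a, b, c) <= qf_coefnorm q (a', b', c').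
Proof.
move=> + ha hb hc; case: q => [q| |] q1; rewrite /qf_coefnorm.
- have q0 : 0 <= q by rewrite lee_fin in q1; exact: le_trans q1.
  have powR_le u v : `|u| <= `|v| -> `|u| `^ q <= `|v| `^ q.
    by move=> uv; rewrite ge0_ler_powR ?nnegrE.
  by rewrite ge0_ler_powR ?invr_ge0 ?nnegrE ?addr_ge0 ?powR_ge0 ?lerD ?powR_le.
- by rewrite !ge_max !le_max ha hb hc !orbT.
(* At [-oo] both sides are the default value 0. *)
- exact: lexx.
Qed.

(** For finite q, |k|^q factors out of the sum and the outer exponent 1/q turns it back into |k|;
    for [+oo], |k| passes through the maxima. *)
Lemma qf_coefnormZ (R : realType) (q : \bar R) (k a b c : R) :
  (1 <= q)%E ->
  qf_coefnorm q (k * a, k * b, k * c) = `|k| * qf_coefnorm q (a, b, c).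
Proof.
case: q => [q| |] //= q1; rewrite !normrM.
- have q0 : q != 0 by rewrite lee_fin in q1; apply: lt0r_neq0; exact: lt_le_trans q1.
  rewrite !powRM // -!mulrDr powRM ?powR_ge0 ?addr_ge0 ?powR_ge0 //.
  by rewrite -powRrM mulfV // powRr1.
- by rewrite !maxr_pMr.
Qed.

Lemma qf_coefnormN (R : realType) (q : \bar R) (P : quadform R) :
  qf_coefnorm q (- P) = qf_coefnorm q P.
Proof. by case: P => [[a b] c]; rewrite /= !normrN. Qed.

Lemma qf_supnormN (R : realType) (P : quadform R) :
  qf_supnorm (- P) = qf_supnorm P.
Proof.
rewrite /qf_supnorm; congr sup; apply: eq_imagel => -[x y] _ /=.
by case: P => [[a b] c] /=; rewrite !mulNr -!opprD normrN.
Qed.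

Lemma qf_supnorm_Pstar (R : realType) : qf_supnorm (Pstar R) = 1.
Proof.
apply/le_anti/andP; split; last first.
  (* The coefficient of x^2 has absolute value 1, which bounds the sup norm from below. *)
  by have [+ _ _] := qf_coef_bounds R (-1) 4 (-1); rewrite normrN1.
apply: ge_sup; first by have [] := qf_supnorm_has_sup (Pstar R).
move=> _ [[x y] [/= /andP[x0 x1] /andP[y0 y1] xy] <-] /=.
have s2 : Num.sqrt 2 ^+ 2 = 2 :> R by rewrite sqr_sqrtr.
have xy2 : (x + y) ^+ 2 <= 2.
  by rewrite -s2 ler_sqr ?nnegrE ?sqrtr_ge0 ?addr_ge0.
(* Upper bound: P_* = (x + y)^2 / 2 - 3 (x - y)^2 / 2 <= 1. *)
rewrite ler_norml; apply/andP; split; last by have := sqr_ge0 (x - y); nra.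
(* The larger variable is at most 1, and 4 x y absorbs the smaller square. *)
by case: (leP x y) => h; nra.
Qed.

Lemma coef_constE (R : realType) (q : \bar R) :
  (1 <= q)%E -> coef_const q = (qf_coefnorm q (Pstar R))%:E.
Proof.
move=> q1; apply/le_anti/andP; split.
- apply: ge_ereal_sup => _ [[[a b] c] /= P0 <-].
  have N0 := qf_supnorm_gt0 P0.
  (* Homogeneity moves the sup norm N into the coefficients, so that P is compared with N P_*
     coefficient by coefficient. *)
  rewrite lee_fin ler_pdivrMr // mulrC -[X in X * _](gtr0_norm N0) -qf_coefnormZ //.
  have [ha hb hc] := qf_coef_bounds R a b c.
  by apply: qf_coefnorm_le; rewrite // normrM (gtr0_norm N0) ?normrN1 ?mulr1 //
    ger0_norm // mulrC.
- apply: ereal_sup_ubound; exists (Pstar R) => /=.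
    by apply/eqP => -[/eqP]; rewrite oppr_eq0 oner_eq0.
  by rewrite qf_supnorm_Pstar divr1.
Qed.

Theorem theorem6p2 (R : realType) :
  (forall q : R, 1 <= q ->
     coef_const q%:E = ((2 + 4 `^ q) `^ q^-1)%:E) /\
  coef_const (+oo : \bar R)%E = 4%:E /\
  (forall (q : \bar R) (P : quadform R), (1 <= q)%E ->
     P = Pstar R \/ P = - Pstar R ->
     (qf_coefnorm q P)%:E = (coef_const q * (qf_supnorm P)%:E)%E).
Proof.
split; [|split].
- move=> q; rewrite -lee_fin => /coef_constE ->.
  rewrite /qf_coefnorm /Pstar normrN1 powR1 (ger0_norm (ler0n R 4)).
  (* The two outer terms are brought together; their sum 1 + 1 is 2 by conversion. *)
  by rewrite addrAC.
- rewrite coef_constE ?leey //= normrN1 ger0_norm //.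
  by rewrite (max_l (_ : 1 <= 4)) ?max_r ?ler1n.
- move=> q P q1 [] ->; rewrite ?qf_coefnormN ?qf_supnormN qf_supnorm_Pstar;
    by rewrite coef_constE // mule1.
Qed.
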